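(* Let $X$ be a separable complete metric space, let $\mathcal{T}$ be either $[0,+\infty)$ or $\{0,1,2,\dots\}$, and let $\Omega=C(\mathcal{T}\to X)$. Let $S$ be a set-valued map assigning to each $x\in X$ a subset $S(x)\subset\Omega$ such that: (S1) for every $x\in X$, $S(x)$ is a non-empty compact subset of $\Omega_x$; (S2) for every closed set $K\subset\Omega$, the set $\{x\in X: S(x)\cap K\neq\emptyset\}$ is Borel in $X$; (S3) for all $x\in X$, $s\in\mathcal{T}$, if $w\in S(x)$ then $\theta_s(w)\in S(w(s))$; (S4) for all $x\in X$, $s\in\mathcal{T}$, if $w\in S(x)$ and $v\in S(w(s))$, then $w\bowtie_s v\in S(x)$. Then $S$ has a measurable selection $\mathfrak{u}$, i.e. a Borel measurable map $\mathfrak u:X\to\Omega$, $x\mapsto \mathfrak{u}(\cdot,x)$, with $\mathfrak{u}(\cdot,x)\in S(x)$ for all $x\in X$, that has the semigroup property $$\mathfrak{u}(t_2,\mathfrak{u}(t_1,x))=\mathfrak{u}(t_1+t_2,x)\quad\text{for all } t_1,t_2\in\mathcal{T}\text{ and all }x\in X.$$ Moreover, for every $t\in\mathcal{T}$ the map $U(t):X\to X$, $U(t)(x)=\mathfrak{u}(t,x)$, is Borel measurable (and these maps form the corresponding semigroup).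
   Context: $\Omega=C(\mathcal{T}\to X)$ is the space of continuous paths $w:\mathcal{T}\to X$ (all sequences when time is discrete) with the topology of uniform convergence on compact subsets of $\mathcal{T}$; it is a separable, completely metrizable space. $\Omega_x=\{w\in\Omega: w(0)=x\}$. The shift $\theta_s:\Omega\to\Omega$ is $(\theta_s w)(t)=w(s+t)$. If $w,v\in\Omega$ and $w(s)=v(0)$, the splicing $w\bowtie_s v\in\Omega$ is defined by $(w\bowtie_s v)(t)=w(t)$ for $0\le t\le s$ and $(w\bowtie_s v)(t)=v(t-s)$ for $t\ge s$. $\mathfrak{u}(t,x)$ denotes the position at time $t$ of the path $\mathfrak{u}(\cdot,x)$. Measurability is with respect to the Borel $\sigma$-algebras of $X$ and $\Omega$. *)

(* Defs.v *)
From HB Require Import structures.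
From mathcomp Require Import all_boot all_order all_algebra.
From mathcomp Require Import all_classical all_reals all_analysis.

Set Implicit Arguments.
Unset Strict Implicit.
Unset Printing Implicit Defensive.

Import Order.TTheory GRing.Theory Num.Theory.
Import numFieldNormedType.Exports.

Local Open Scope classical_set_scope.
Local Open Scope ring_scope.

(* The library's [completeType] and [measurableType] are pointed.  The notions
   of completeness and Borel measurability below are those of the library,
   stated without that restriction. *)

Definition separable_space (X : topologicalType) : Prop :=
  exists2 D : set X, countable D & dense D.

Definition complete_space (X : uniformType) : Prop :=
  forall F : set_system X, ProperFilter F -> cauchy F -> exists x : X, F --> x.

Definition borel_set (X : topologicalType) : set (set X) := <<s open >>.

Definition borel_measurable (X Y : topologicalType) (f : X -> Y) : Prop :=
  forall B : set Y, borel_set B -> borel_set (f @^-1` B).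

Variant time_kind := ContinuousTime | DiscreteTime.

Definition time_set (R : realType) (k : time_kind) : set R :=
  match k with
  | ContinuousTime => [set t | 0 <= t]
  | DiscreteTime => range (fun n : nat => n%:R)
  end.

Arguments time_set : clear implicits.

(* The subspace topology inherited from [R]; it is discrete when time is. *)
Definition time (R : realType) (k : time_kind) : Type :=
  set_type (time_set R k).

HB.instance Definition _ R k := Topological.on (time R k).

Definition time_val (R : realType) (k : time_kind) (t : time R k) : R :=
  set_val t.

Section Time.
Context {R : realType} {k : time_kind}.
Local Notation T := (time R k).
Implicit Types r s t : T.

Lemma time_valP t : time_set R k (time_val t).
Proof. exact: set_valP. Qed.

Lemma time_val_inj : injective (@time_val R k).
Proof. exact: val_inj. Qed.

Lemma time_val_ge0 t : 0 <= time_val t.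
Proof.
by move: (time_valP t); move: (time_val t) => x; case: k => //= -[n _ <-].
Qed.

Let time_set0 : time_set R k 0.
Proof. by case: k => //=; exists 0%N. Qed.

Let time_setD s t : time_set R k (time_val s + time_val t).
Proof.
move: (time_valP t) (time_valP s); move: (time_val t) (time_val s) => y x.
case: k => /=; first by move=> y0 x0; exact: addr_ge0.
by move=> [n _ <-] [m _ <-]; exists (m + n)%N; rewrite ?natrD.
Qed.

Let time_setB t s : time_set R k (Num.max 0 (time_val t - time_val s)).
Proof.
move: (time_valP t) (time_valP s); move: (time_val t) (time_val s) => y x.
case: k => /=; first by rewrite le_max lexx.
move=> [n _ <-] [m _ <-]; exists (n - m)%N => //.
have [nm|/ltnW mn] := leqP n m.
  have /eqP -> : (n - m == 0)%N by rewrite subn_eq0.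
  by apply/esym/max_idPl; rewrite subr_le0 ler_nat.
by rewrite natrB//; apply/esym/max_idPr; rewrite subr_ge0 ler_nat.
Qed.

Definition time_zero : T := SigSub (mem_set time_set0).

Definition time_add s t : T := SigSub (mem_set (time_setD s t)).

(* Truncated: [t - s] if [s <= t], and [0] otherwise. *)
Definition time_sub t s : T := SigSub (mem_set (time_setB t s)).

Let time_addA : associative time_add.
Proof. by move=> r s t; apply: time_val_inj; exact: addrA. Qed.

Let time_addC : commutative time_add.
Proof. by move=> s t; apply: time_val_inj; exact: addrC. Qed.

Let time_add0 : left_id time_zero time_add.
Proof. by move=> t; apply: time_val_inj; exact: add0r. Qed.

HB.instance Definition _ :=
  GRing.isNmodule.Build (time R k) time_addA time_addC time_add0.

Lemma time_val0 : time_val (0 : T) = 0. Proof. by []. Qed.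

Lemma time_valD s t : time_val (s + t) = time_val s + time_val t.
Proof. by []. Qed.

Lemma time_valB t s : time_val (time_sub t s) =
  Num.max 0 (time_val t - time_val s).
Proof. by []. Qed.

Lemma time_val_continuous : continuous (@time_val R k).
Proof. exact: (@initial_continuous (set_type (time_set R k)) R set_val). Qed.

Lemma continuous_to_time (Y : topologicalType) (f : Y -> T) :
  continuous (@time_val R k \o f) -> continuous f.
Proof.
exact: (@continuous_comp_initial (set_type (time_set R k)) Y R set_val f).
Qed.

Lemma time_add_continuous s : continuous (fun t => s + t).
Proof.
apply: continuous_to_time => t.
apply: (@cvgD R R^o T (nbhs t) _ (cst (time_val s)) (@time_val R k)).
  exact: cvg_cst.
exact: time_val_continuous.
Qed.

Lemma time_sub_continuous s : continuous (fun t => time_sub t s).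
Proof.
apply: continuous_to_time => t.
apply: (@continuous_max R T (cst 0) (fun t => time_val t - time_val s)).
  exact: cst_continuous.
apply: (@cvgB R R^o T (nbhs t) _ (@time_val R k) (cst (time_val s))).
  exact: time_val_continuous.
exact: cvg_cst.
Qed.

End Time.

Definition path_space (R : realType) (k : time_kind) (X : uniformType) : Type :=
  continuousType (time R k) X.

HB.instance Definition _ R k X := Choice.on (path_space R k X).

(* A path as an element of the space of all functions under uniform convergence
   on compact sets; the path space gets the topology induced by this map. *)
Definition path_fun (R : realType) (k : time_kind) (X : uniformType)
    (w : path_space R k X) : {family compact, time R k -> X} :=
  fun t => w t.

HB.instance Definition _ R k X :=
  Uniform.copy (path_space R k X) (initial_topology (@path_fun R k X)).

Section Paths.
Context {R : realType} {k : time_kind} {X : uniformType}.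
Local Notation T := (time R k).
Local Notation Omega := (path_space R k X).
Implicit Types (s t : T) (w v : Omega).

Definition paths_from (x : X) : set Omega := [set w | w 0 = x].

Lemma path_continuous w : continuous w.
Proof. exact: (@cts_fun _ _ (w : continuousType T X)). Qed.

Let path_shift_continuous s w : continuous (fun t => w (s + t)).
Proof.
move=> t; apply: (continuous_comp (f := fun t => s + t)).
  exact: time_add_continuous.
exact: path_continuous.
Qed.

Definition path_shift s w : Omega := mkcts (@path_shift_continuous s w).

Definition splice_fun s w v : T -> X :=
  fun t => if time_val t <= time_val s then w t else v (time_sub t s).

Let splice_continuous s w v : w s = v 0 -> continuous (splice_fun s w v).
Proof.
move=> wsv0; pose A := [set t : T | time_val t <= time_val s].
pose B := [set t : T | time_val s <= time_val t].
have cA : closed A.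
  by apply: (@preimage_closed _ _ (@time_val R k) [set x : R | x <= time_val s]);
    [move=> ? _; exact: time_val_continuous | exact: closed_le].
have cB : closed B.
  by apply: (@preimage_closed _ _ (@time_val R k) [set x : R | time_val s <= x]);
    [move=> ? _; exact: time_val_continuous | exact: closed_ge].
apply/continuous_subspace_setT.
have -> : [set: T] = A `|` B.
  apply/seteqP; split=> // t _; have [ts|st] := leP (time_val t) (time_val s).
    by left.
  by right; exact: ltW.
apply: withinU_continuous => //.
  apply: (@subspace_eq_continuous _ A _ w).
    by move=> t /set_mem ts; rewrite /from_subspace /splice_fun ifT.
  by apply: continuous_subspaceT; exact: path_continuous.
apply: (@subspace_eq_continuous _ B _ (fun t => v (time_sub t s))).
  move=> t /set_mem st; rewrite /from_subspace /splice_fun.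
  case: ifPn => // ts; have -> : t = s.
    by apply/time_val_inj/eqP; rewrite eq_le ts st.
  by rewrite wsv0; congr (v _); apply: time_val_inj; rewrite time_valB subrr maxxx.
apply: continuous_subspaceT => t; apply: (continuous_comp (f := time_sub^~ s)).
  exact: time_sub_continuous.
exact: path_continuous.
Qed.

Definition path_splice s w v (wsv0 : w s = v 0) : Omega :=
  mkcts (splice_continuous wsv0).

Definition time_map (u : X -> Omega) t : X -> X := fun x => u x t.

End Paths.

(* Main.v *)
(* Krylov's selection scheme.  For a functional of discounted form
   [F w = \int_0^oo e^(-lambda t) phi (w t) dt], the paths of [S x] maximizing
   [F] form a set-valued map that again satisfies (S1)-(S4): splicing turns a
   better tail into a better path, which is the dynamic programming principle.
   Maximizing successively over all [lambda = n + 1] and all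
   [phi = min (1, d (p, _))], with [p] in a countable dense set, and
   intersecting leaves one path in each [S x], as a continuous bounded function
   is determined by its Laplace transform at the positive integers.  A
   single-valued map satisfying (S2) is Borel, and (S3) is the semigroup
   property.

   The substitution [x = e^(-t)] turns the Laplace transforms into moments of
   functions on [`]0, 1]], and discrete paths are treated as right-continuous
   step functions of a real time. *)

Require Import Defs.
From mathcomp Require Import all_boot all_order all_algebra.
From mathcomp Require Import all_classical all_reals all_analysis.
From mathcomp Require Import measurable_realfun ring lra.

Set Implicit Arguments.
Unset Strict Implicit.
Unset Printing Implicit Defensive.

Import Order.TTheory GRing.Theory Num.Theory.
Import numFieldNormedType.Exports.

Local Open Scope classical_set_scope.
Local Open Scope ring_scope.

(** * Moments on ]0, 1] *)

Section Moments.
Context {R : realType}.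
Local Notation mu := (@lebesgue_measure R).
Local Notation I01 := (`]0%R, 1%R]%classic : set R).
Implicit Types (f g : R -> R) (a b c e x : R) (D : set R) (n : nat).

(** Lebesgue measure is [c] times its image under multiplication by [c]: the two agree on the
    intervals []a, b]], and this determines the measure. *)
Lemma ge0_integral_scale c D (f : R -> \bar R) : 0 < c ->
  measurable D -> measurable_fun D f -> (forall x, D x -> 0 <= f x)%E ->
  (\int[mu]_(x in D) f x =
   c%:E * \int[mu]_(x in (fun x => c * x)%R @^-1` D) f (c * x)%R)%E.
Proof.
move=> c0 mD mf f0; pose p : {nonneg R} := NngNum (ltW c0).
pose phi : measurableTypeR R -> measurableTypeR R := fun x => c * x.
have mphi : measurable_fun setT phi by exact: mulrl_measurable.
have [nu nuE] : exists nu : {measure set (measurableTypeR R) -> \bar R},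
    nu = pushforward mu phi :> (set (measurableTypeR R) -> \bar R).
  by unshelve eexists (pushforward mu phi) => //.
transitivity (\int[mscale p nu]_(x in D) f x)%E; last first.
  rewrite ge0_integral_mscale// nuE ge0_integral_pushforward// => x /set_mem.
  exact: f0.
apply: eq_measure_integral => //= A mA AD.
apply: lebesgue_measure_unique => // _ [[a b]] _ <- /=.
rewrite /mscale nuE /pushforward; cbv beta.
  rewrite [X in _ = (_ * mu X)%E](_ : _ = `]c^-1 * a, c^-1 * b]%classic);
    last first.
    apply/seteqP; split=> x /=; rewrite !in_itv/= /phi.
      by rewrite ltr_pdivrMl// ler_pdivlMl.
    by rewrite ltr_pdivrMl// ler_pdivlMl.
  rewrite !lebesgue_measure_itv/= !lte_fin ltr_pM2l ?invr_gt0//.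
  case: ifP => _; rewrite ?mule0// -!EFinB -EFinM -mulrBr mulrA.
  by rewrite divff ?gt_eqF// mul1r.
Qed.

Lemma measurableI01 : @measurable _ (measurableTypeR R) I01.
Proof. exact: measurable_itv. Qed.

Lemma bounded_integrable D f e : measurable D -> D `<=` I01 ->
  measurable_fun setT f -> (forall x, D x -> `|f x| <= e) ->
  mu.-integrable D (EFin \o f).
Proof.
move=> mD DI mf fe; apply: measurable_bounded_integrable => //.
- apply: (@le_lt_trans _ _ (mu I01)).
    by apply: le_measure; rewrite ?inE.
  by rewrite lebesgue_measure_itv/= lte_fin ltr01 -EFinB ltry.
- exact: measurable_funTS.
- exists e; split; first exact: num_real.
  by move=> y ey x Dx; exact: le_trans (fe _ Dx) (ltW ey).
Qed.

Lemma le_normr_Rintegral_itv a b f e : 0 <= a -> a <= b -> b <= 1 ->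
  measurable_fun setT f -> (forall x, a < x <= b -> `|f x| <= e) ->
  `|\int[mu]_(x in `]a, b]) f x| <= e * (b - a).
Proof.
move=> a0 ab b1 mf fe.
have mD : measurable (`]a, b]%classic : set R) by exact: measurable_itv.
have DI : `]a, b] `<=` I01.
  move=> x /=; rewrite !in_itv/= => /andP[ax xb].
  by rewrite (le_lt_trans a0 ax) (le_trans xb b1).
have feD x : `]a, b]%classic x -> `|f x| <= e by rewrite /= in_itv/=; exact: fe.
have intf := bounded_integrable mD DI mf feD.
apply: (@le_trans _ _ (\int[mu]_(x in `]a, b]) `|f x|)).
  exact: le_normr_Rintegral.
apply: (@le_trans _ _ (\int[mu]_(x in `]a, b]) e)).
  apply: le_Rintegral => //.
    by apply: (@bounded_integrable _ _ e) => //; [exact: measurableT_comp|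
      move=> x Dx; rewrite normr_id; exact: feD].
  by apply: (@bounded_integrable _ _ `|e|) => // x _; rewrite /= .
have muab : mu `]a, b] = (b - a)%:E.
  rewrite lebesgue_measure_itv/= lte_fin; case: ltP => [_|ba].
    by rewrite -EFinB.
  by have -> : b = a; [apply/eqP; rewrite eq_le ab ba|rewrite subrr].
by rewrite Rintegral_cst//= muab.
Qed.

Definition moment n f : R := \int[mu]_(x in I01) (x ^+ n * f x).

Lemma measurable_monomial n f : measurable_fun setT f ->
  measurable_fun setT (fun x => x ^+ n * f x).
Proof. by move=> mf; apply: measurable_funM => //; exact: measurable_funX. Qed.

Lemma monomial_bound n f x e :
  0 < x <= 1 -> `|f x| <= e -> `|x ^+ n * f x| <= e.
Proof.
move=> /andP[x0 x1] fe; rewrite normrM; apply: le_trans fe.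
by rewrite ler_piMl// ger0_norm ?exprn_ge0 ?exprn_ile1// ltW.
Qed.

Lemma moment_integrable n f D e : measurable D -> D `<=` I01 ->
  measurable_fun setT f ->
  (forall x, 0 < x <= 1 -> `|f x| <= e) ->
  mu.-integrable D (EFin \o (fun x => x ^+ n * f x)).
Proof.
move=> mD DI mf fe; apply: (@bounded_integrable _ _ e) => //.
  exact: measurable_monomial.
move=> x /DI; rewrite /= in_itv/= => x01; apply: monomial_bound => //.
exact: fe.
Qed.

Lemma momentB n f g : measurable_fun setT f -> measurable_fun setT g ->
  (forall x, 0 < x <= 1 -> `|f x| <= 1) ->
  (forall x, 0 < x <= 1 -> `|g x| <= 1) ->
  moment n (f \- g) = moment n f - moment n g.
Proof.
move=> mf mg f1 g1; rewrite /moment -RintegralB ?measurableI01//.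
- by apply: eq_Rintegral => x _; rewrite mulrBr.
- exact: moment_integrable f1.
- exact: moment_integrable g1.
Qed.

Lemma moment_split n f c : 0 < c <= 1 -> measurable_fun setT f ->
  (forall x, 0 < x <= 1 -> `|f x| <= 1) ->
  moment n f = \int[mu]_(x in `]0, c]) (x ^+ n * f x) +
               \int[mu]_(x in `]c, 1]) (x ^+ n * f x).
Proof.
move=> /andP[c0 c1] mf f1.
have I01E : I01 = `]0, c] `|` `]c, 1].
  by rewrite -itv_bndbnd_setU// bnd_simp// ltW.
rewrite /moment I01E Rintegral_setU//=.
- by rewrite -I01E; exact: moment_integrable f1.
- apply/disj_setPS => y [/=]; rewrite 2!in_itv/= => /andP[_ yc] /andP[].
  by rewrite ltNge yc.
Qed.

(** Substituting [c * x] for [x] takes [c ^+ n] out of the monomial and one more [c] out of the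
    measure. For [c = e^(-s)] the interval []0, c]] carries the times from [s] on, so this is a time
    shift seen through the exponential. *)
Lemma moment_scale n f c : 0 < c <= 1 -> measurable_fun setT f ->
  (forall x, 0 < x <= 1 -> 0 <= f x <= 1) ->
  \int[mu]_(x in `]0, c]) (x ^+ n * f x) =
  c ^+ n.+1 * moment n (fun x => f (c * x)).
Proof.
move=> /andP[c0 c1] mf f01.
have f1 x : 0 < x <= 1 -> `|f x| <= 1.
  by move=> /f01/andP[? ?]; rewrite ger0_norm.
have mfc : measurable_fun setT (fun x => f (c * x)).
  by apply: measurableT_comp => //; exact: mulrl_measurable.
have cx x : 0 < x <= 1 -> 0 < c * x <= 1.
  by move=> /andP[x0 x1]; rewrite mulr_gt0// mulr_ile1// ltW.
rewrite /Rintegral (ge0_integral_scale c0)//; last 2 first.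
- by apply/measurable_EFinP/measurable_funTS; exact: measurable_monomial.
- move=> x /=; rewrite in_itv/= => /andP[x0 xc]; rewrite lee_fin.
  have /f01/andP[fx0 _] : 0 < x <= 1 by rewrite x0 (le_trans xc).
  by rewrite mulr_ge0// exprn_ge0// ltW.
rewrite (_ : _ @^-1` _ = I01); last first.
  by apply/seteqP; split=> x /=; rewrite !in_itv/= pmulr_rgt0// ger_pMr.
have intfc : mu.-integrable I01 (EFin \o (fun x => x ^+ n * f (c * x))).
  by apply: (@moment_integrable _ _ _ 1) => // x /cx/f1.
under eq_integral do rewrite exprMn -mulrA EFinM.
rewrite integralZl// muleA -EFinM -exprS fineM//.
exact: integrable_fin_num intfc.
Qed.

(** On []0, c]] the difference is at most 1 and the length is [c]; elsewhere it is at most [e].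
    Hence closeness on a bounded range of times controls the moments. *)
Lemma moment_dist n f g c e : 0 < c <= 1 -> 0 <= e ->
  measurable_fun setT f -> measurable_fun setT g ->
  (forall x, 0 < x <= 1 -> 0 <= f x <= 1) ->
  (forall x, 0 < x <= 1 -> 0 <= g x <= 1) ->
  (forall x, c < x <= 1 -> `|f x - g x| <= e) ->
  `|moment n f - moment n g| <= c + e.
Proof.
move=> c01 e0 mf mg f01 g01 fge; have /andP[c0 c1] := c01.
have f1 x : 0 < x <= 1 -> `|f x| <= 1.
  by move=> /f01/andP[? ?]; rewrite ger0_norm.
have g1 x : 0 < x <= 1 -> `|g x| <= 1.
  by move=> /g01/andP[? ?]; rewrite ger0_norm.
have mfg : measurable_fun setT (f \- g) by exact: measurable_funB.
have fg1 x : 0 < x <= 1 -> `|(f \- g) x| <= 1.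
  move=> x01; have /andP[? ?] := f01 _ x01; have /andP[? ?] := g01 _ x01.
  by rewrite /= ler_norml; apply/andP; split; lra.
rewrite -momentB//.
rewrite (moment_split n c01)//; apply: le_trans (ler_normD _ _) _; apply: lerD.
  rewrite -[leRHS]mul1r -[in leRHS](subr0 c).
  apply: le_normr_Rintegral_itv => //.
  - exact: ltW.
  - exact: measurable_monomial.
  move=> x /andP[x0 xc].
  have x01 : 0 < x <= 1 by rewrite x0 (le_trans xc).
  by apply: monomial_bound => //; exact: fg1.
apply: (@le_trans _ _ (e * (1 - c))); last first.
  by rewrite ler_piMr// gerBl ltW.
apply: le_normr_Rintegral_itv => //; first exact: ltW.
  exact: measurable_monomial.
move=> x xc; have /andP[cx x1] := xc; apply: monomial_bound.
  by rewrite (lt_trans c0).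
exact: fge.
Qed.

Lemma horner_moment g (p : {poly R}) : measurable_fun setT g ->
  (forall x, 0 < x <= 1 -> `|g x| <= 1) -> (forall n, moment n g = 0) ->
  mu.-integrable I01 (EFin \o (fun x => p.[x] * g x)) /\
  \int[mu]_(x in I01) (p.[x] * g x) = 0.
Proof.
move=> mg g1 g0.
(* The extra [x ^+ n] lets the induction on [p] move a factor ['X] into the monomial; integrability
   is carried along for the linearity of the integral. *)
suff H : forall n,
    mu.-integrable I01 (EFin \o (fun x => p.[x] * (x ^+ n * g x))) /\
    \int[mu]_(x in I01) (p.[x] * (x ^+ n * g x)) = 0.
  suff -> : (fun x => p.[x] * g x) = (fun x => p.[x] * (x ^+ 0 * g x)).
    exact: H.
  by apply/funext => x; rewrite expr0 mul1r.
elim/poly_ind: p => [n|p c ih n].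
  have -> : (fun x => (0 : {poly R}).[x] * (x ^+ n * g x)) = cst 0.
    by apply/funext => x; rewrite horner0 mul0r.
  rewrite Rintegral_cst ?measurableI01// mul0r; split => //.
  exact: integrable0.
have -> : (fun x => (p * 'X + c%:P).[x] * (x ^+ n * g x)) =
    (fun x => p.[x] * (x ^+ n.+1 * g x) + c * (x ^+ n * g x)).
  by apply/funext => x; rewrite hornerD hornerM hornerX hornerC exprS; ring.
have [ip p0] := ih n.+1.
have ig : mu.-integrable I01 (EFin \o (fun x => x ^+ n * g x)).
  exact: moment_integrable g1.
have icg : mu.-integrable I01 (EFin \o (fun x => c * (x ^+ n * g x))).
  by have := integrableZl measurableI01 c ig.
split; first exact: (integrableD measurableI01 ip icg).
rewrite RintegralD ?measurableI01// p0 RintegralZl ?measurableI01//.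
by rewrite add0r; have := g0 n; rewrite /moment => ->; rewrite mulr0.
Qed.

Lemma expr_unbounded (y z : R) : 1 < y -> exists n, z < y ^+ n.
Proof.
rewrite -subr_gt0 => y1.
have bernoulli n : 1 + n%:R * (y - 1) <= y ^+ n.
  elim: n => [|n ih]; first by rewrite mul0r expr0 addr0.
  have n0 : 0 <= n%:R :> R by [].
  rewrite exprS -natr1; set Y := y ^+ n in ih *; set d := y - 1 in y1 ih *.
  have -> : y = 1 + d by rewrite /d; lra.
  have := mulr_ge0 (ltW y1) n0; nra.
exists (Num.bound `|z / (y - 1)|); apply: lt_le_trans (bernoulli _).
apply: ltr_wpDl => //.
rewrite -ltr_pdivrMr//; apply: le_lt_trans (ler_norm _) _.
exact: archi_boundP.
Qed.

(* If all the moments of [g] vanish then [\int q^N g = 0] for every [N], where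
   [q = 1 + r^2 - (x - m)^2] exceeds 1 exactly on the interval [`]a, b[] of
   center [m] and radius [r]; as [N] grows the contribution of that interval
   is unbounded, while that of its complement stays bounded by 1. *)
Lemma moments_nonzero g a b e : 0 <= a -> a < b -> b <= 1 -> 0 < e ->
  measurable_fun setT g -> (forall x, 0 < x <= 1 -> `|g x| <= 1) ->
  (forall x, a < x < b -> e <= g x) ->
  exists n, moment n g != 0.
Proof.
move=> a0 ab b1 e0 mg g1 ge; apply: contrapT => /forallNP g0.
have {}g0 n : moment n g = 0 by apply/eqP/negPn/negP; exact: g0.
pose m := (a + b) / 2; pose r := (b - a) / 2.
have r0 : 0 < r by rewrite divr_gt0 ?subr_gt0.
have bE : b = m + r by rewrite /m /r; lra.
have aE : a = m - r by rewrite /m /r; lra.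
pose q : {poly R} := (1 + r ^+ 2)%:P - ('X - m%:P) ^+ 2.
have qE x : q.[x] = 1 + r ^+ 2 - (x - m) ^+ 2 by rewrite !hornerE.
(* [K] bounds [q] from below on [J], the middle half of []a, b[]. As [J] has length [r], it
   contributes at least [e * K ^+ N * r], which exceeds 1 by the choice of [N]. *)
pose K := 1 + r ^+ 2 - (r / 2) ^+ 2.
pose J := `]m - r / 2, m + r / 2[%classic : set R.
have K1 : 1 < K by rewrite /K; nra.
have [N KN] := expr_unbounded (e * r)^-1 K1.
have [intq q0] := horner_moment (q ^+ N) mg g1 g0.
have JI : J `<=` I01.
  by move=> x; rewrite /J/= !in_itv/= => /andP[x1 x2]; apply/andP; split; lra.
have mJ : measurable J by exact: measurable_itv.
(* On [J], [q >= K] and [g >= e]; on the rest of []a, b[] both factors are nonnegative; outside,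
   both have absolute value at most 1. *)
have lower x : I01 x -> e * K ^+ N * \1_J x - 1 <= (q ^+ N).[x] * g x.
  rewrite /= in_itv/= => x01; rewrite horner_exp indicE.
  have /andP[x0 x1] := x01.
  have [xab|xab] := boolP (a < x < b).
    have gx := ge _ xab; have /andP[xa xb] := xab.
    have q1 : 1 <= q.[x] by rewrite qE; nra.
    have [|_] := boolP (x \in J); last first.
      rewrite mulr0 sub0r (@le_trans _ _ 0) ?lerN10// mulr_ge0 ?exprn_ge0//.
        exact: le_trans q1.
      exact: le_trans (ltW e0) gx.
    rewrite inE /J/= in_itv/= => /andP[xJ1 xJ2].
    rewrite mulr1 (@le_trans _ _ (e * K ^+ N)) ?gerBl// mulrC.
    apply: ler_pM => //; rewrite ?exprn_ge0 ?(ltW e0)//; first lra.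
    apply: lerXn2r; rewrite ?nnegrE; [lra|lra|].
    by rewrite qE /K; nra.
  have -> : x \in J = false.
    apply/negbTE/negP; rewrite inE /J/= in_itv/= => /andP[xJ1 xJ2].
    by move/negP: xab; apply; apply/andP; split; lra.
  rewrite mulr0 sub0r; apply: lerNnormlW.
  rewrite normrM -[leRHS]mul1r; apply: ler_pM => //; last exact: g1.
  (* Both [x] and [m] lie in the unit interval, so [(x - m)^2 <= 1]. *)
  have q0x : 0 <= q.[x] by rewrite qE; nra.
  have qx1 : q.[x] <= 1.
    rewrite qE; move: xab; rewrite negb_and -!leNgt => /orP[]; nra.
  by rewrite normrX ger0_norm// exprn_ile1.
have intJ : mu.-integrable I01 (EFin \o (\1_J : R -> R)).
  apply: (@bounded_integrable _ _ 1) => //.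
  by move=> x _; rewrite indicE; case: (_ \in _); rewrite ?normr1 ?normr0.
have intcJ : mu.-integrable I01 (EFin \o (fun x => e * K ^+ N * \1_J x)).
  by have := integrableZl measurableI01 (e * K ^+ N) intJ.
have int1 : mu.-integrable I01 (EFin \o (cst 1 : R -> R)).
  by apply: (@bounded_integrable _ _ 1) => // x _; rewrite normr1.
have intl : mu.-integrable I01 (EFin \o (fun x => e * K ^+ N * \1_J x - 1)).
  by have := integrableB measurableI01 intcJ int1.
have := le_Rintegral measurableI01 intl intq lower.
have -> : \int[mu]_(x in I01) (e * K ^+ N * \1_J x - 1) = e * K ^+ N * r - 1.
  have muJ : \int[mu]_(x in I01) \1_J x = r.
    rewrite /Rintegral integral_indic// setIidl//=.
    rewrite lebesgue_measure_itv/= lte_fin ifT; last lra.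
    by rewrite -EFinB/=; lra.
  have mu1 : \int[mu]_(x in I01) 1 = 1 :> R.
    rewrite Rintegral_cst//= lebesgue_measure_itv/= lte_fin ltr01 mul1r.
    by rewrite -EFinB/= subr0.
  rewrite (RintegralB measurableI01 intcJ int1).
  by rewrite (RintegralZl _ measurableI01 intJ) muJ mu1.
rewrite q0 subr_le0 leNgt => /negP; apply.
have er0 : 0 < e * r by exact: mulr_gt0.
by rewrite mulrAC -ltr_pdivrMl// mulr1.
Qed.
End Moments.

(** * Maximization over paths *)

Section Borel.
Context {X : topologicalType}.
Implicit Types (A B : set X).

Lemma borel_open A : open A -> borel_set A.
Proof. exact: sub_sigma_algebra. Qed.

Lemma borel_setC A : borel_set A -> borel_set (~` A).
Proof. by rewrite -setTD; exact: sigma_algebraCD. Qed.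

Lemma borel_bigcup (A : (set X)^nat) :
  (forall n, borel_set (A n)) -> borel_set (\bigcup_n A n).
Proof. exact: sigma_algebra_bigcup. Qed.

Lemma borel_bigcap (A : (set X)^nat) :
  (forall n, borel_set (A n)) -> borel_set (\bigcap_n A n).
Proof.
move=> bA; rewrite -[X in borel_set X]setCK setC_bigcap; apply: borel_setC.
by apply: borel_bigcup => n; exact: borel_setC.
Qed.

Lemma borel_setD A B : borel_set A -> borel_set B -> borel_set (A `\` B).
Proof.
move=> bA bB; have -> : A `\` B = \bigcap_n (if n is 0 then A else ~` B).
  apply/seteqP; split=> [x [Ax nBx] [|n]//|x ABx].
  by split; [exact: (ABx 0%N)|exact: (ABx 1%N)].
by apply: borel_bigcap => -[//|n]; exact: borel_setC.
Qed.

Lemma borel_bigcup_rat (A : rat -> set X) :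
  (forall q, borel_set (A q)) -> borel_set (\bigcup_q A q).
Proof.
move=> bA.
have -> : \bigcup_q A q =
    \bigcup_n (if unpickle n is Some q then A q else set0).
  apply/seteqP; split=> [x [q _ Aqx]|x [n _]].
    by exists (pickle q); [exact: I|rewrite pickleK; exact: Aqx].
  by case: unpickle => // q Aqx; exists q.
by apply: borel_bigcup => n; case: unpickle => // ; exact: sigma_algebra0.
Qed.

End Borel.

(** The sets with Borel preimage form a sigma-algebra. Closed sets are what (S2) is about. *)
Lemma borel_measurable_closed (X Y : topologicalType) (f : X -> Y) :
  (forall K, closed K -> borel_set (f @^-1` K)) -> borel_measurable f.
Proof.
move=> fK B bB; apply: (bB [set B | borel_set (f @^-1` B)]); split.
  split=> /= [|A bA|A bA].
  - by rewrite preimage_set0; exact: sigma_algebra0.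
  - by rewrite setTD preimage_setC; exact: borel_setC.
  - by rewrite preimage_bigcup; exact: borel_bigcup.
move=> A oA /=; rewrite -[A]setCK preimage_setC.
exact: (borel_setC (fK _ (open_closedC oA))).
Qed.

(** Cantor's intersection theorem: a cluster point of the filter generated by the [C n] lies in each
    of them, as they are closed. *)
Lemma nonincreasing_compact_bigcap (T : topologicalType) (C : (set T)^nat) :
  hausdorff_space T -> (forall n, compact (C n)) ->
  (forall n, C n !=set0) -> (forall n, C n.+1 `<=` C n) ->
  \bigcap_n C n !=set0.
Proof.
move=> hT cC C0 Cdec.
have Cle m n : (m <= n)%N -> C n `<=` C m.
  elim: n => [|n ih]; first by rewrite leqn0 => /eqP ->.
  rewrite leq_eqVlt => /predU1P[-> //|]; rewrite ltnS => /ih Cnm.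
  by apply: subset_trans (Cdec n) Cnm.
pose F := filter_from [set: nat] C.
have FF : ProperFilter F.
  apply: filter_from_proper => //.
  apply: filter_from_filter; first by exists 0%N.
  move=> i j _ _; exists (maxn i j) => // x Cx.
  by split; [exact: Cle (leq_maxl i j) _ Cx|exact: Cle (leq_maxr i j) _ Cx].
have [|p [_ Fp]] := cC 0%N F FF; first by exists 0%N.
exists p => n _; apply: (compact_closed hT (cC n)) => U Up.
by apply: Fp => //; exists n.
Qed.

(** * Set-valued maps satisfying (S1)-(S4) *)

Section Selection.
Context {R : realType} {k : time_kind} {X : metricType R}.
Local Notation T := (time R k).
Local Notation Omega := (path_space R k X).
Implicit Types (S : X -> set Omega) (F : Omega -> R) (w v : Omega) (x : X).
Implicit Types (K : set Omega) (s t : T).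

Lemma nbhs_path w (C : set T) (E : set (X * X)) : compact C -> entourage E ->
  nbhs w [set v | forall t, C t -> E (w t, v t)].
Proof.
move=> cC entE; have := @initial_continuous _ _ (@path_fun R k X) w.
by apply; exact: fam_nbhs.
Qed.

Lemma path_eval_continuous t : continuous (fun w : Omega => w t).
Proof.
move=> w A /=; rewrite -nbhs_entourageE => -[E entE EA].
apply: filterS (nbhs_path w (@compact_set1 _ t) entE) => v /= Ev.
by apply: EA; apply/xsectionP; exact: Ev.
Qed.

Lemma path_eq w v : (forall t, w t = v t) -> w = v.
Proof. by move=> wv; apply/continuousEP => t; exact: wv. Qed.

Lemma path_space_hausdorff : hausdorff_space Omega.
Proof.
move=> w v wv; apply: path_eq => t; apply: (@metric_hausdorff R X).
move=> A B At Bt.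
have [u [Au Bu]] := wv _ _ (path_eval_continuous At) (path_eval_continuous Bt).
by exists (u t).
Qed.

(* Conditions (S1)-(S4). *)
Definition admissible S : Prop :=
  [/\ forall x, [/\ S x !=set0, compact (S x) & S x `<=` paths_from x],
      forall K, closed K -> borel_set [set x | S x `&` K !=set0],
      forall x s w, S x w -> S (w s) (path_shift s w) &
      forall x s w v (wsv0 : w s = v 0),
        S x w -> S (w s) v -> S x (path_splice wsv0)].

(* Splicing a better tail improves the functional; this is the property of
   [w |-> \int_0^oo e^(-lambda t) phi (w t) dt] behind dynamic programming. *)
Definition discounted F : Prop := forall s, exists2 c, 0 < c &
  forall w v (wsv0 : w s = v 0),
    F (path_splice wsv0) - F w = c * (F v - F (path_shift s w)).

Definition argmax S F x : set Omega :=
  [set w | S x w /\ forall v, S x v -> F v <= F w].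

(** One stage of the selection scheme. (S1) comes from compactness, (S2) from comparing maxima
    through rational levels, (S3) and (S4) from dynamic programming. *)
Lemma argmax_admissible S F : continuous F -> discounted F ->
  admissible S -> admissible (argmax S F).
Proof.
move=> cF dF [S1 S2 S3 S4].
have cge q : closed [set w | q <= F w].
  by apply: (@preimage_closed _ _ F [set y | q <= y]);
    [move=> ? _; exact: cF|exact: closed_ge].
have max_exists x K : closed K -> S x `&` K !=set0 ->
    exists2 w, (S x `&` K) w & forall v, (S x `&` K) v -> F v <= F w.
  move=> cK SK0; have [_ cS _] := S1 x.
  have [||w + maxw] := compact_EVT_max SK0 (f := F).
  - exact: compact_closedI.
  - exact: continuous_subspaceT.
  by move/set_mem; exists w => // v SKv; apply: maxw; exact: mem_set.
split=> [x|K cK|x s w [Sw maxw]|x s w v wsv0 [Sw maxw] [Sv maxv]].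
- have [S0 cS Sx] := S1 x.
  have [||w [Sw _]] := max_exists x setT; [exact: closedT|by rewrite setIT|].
  rewrite setIT => maxw.
  have -> : argmax S F x = S x `&` [set v | F w <= F v].
    apply/seteqP; split=> v [Sv maxv]; split=> //; first exact: maxv.
    by move=> u /maxw/le_trans; exact.
  split; [by exists w; split=> //=|exact: compact_closedI|].
  by move=> v [/Sx].
(* The maximizers miss [K] exactly when no path of [S x] lies in [K] or the maximum over those that
   do is smaller than over [S x]. Either way some rational level [q] is reached on [S x] but not
   within [K]. *)
- pose bad q := [set x | S x `&` [set w | q <= F w] !=set0] `\`
                [set x | S x `&` (K `&` [set w | q <= F w]) !=set0].
  rewrite (_ : [set _ | _] = ~` \bigcup_(q : rat) bad (ratr q)); last first.
    apply/seteqP; split=> x /=.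
      move=> [w [[Sw maxw] Kw]] [q _ [[v [Sv qv]] /= []]].
      by exists w; split=> //; split=> //=; exact: le_trans (maxw _ Sv).
    move=> nbad; have [S0 cS Sx] := S1 x.
    have [||w [Sw _]] := max_exists x setT; [exact: closedT|by rewrite setIT|].
    rewrite setIT => maxw.
    have [SK0|nSK] := pselect (S x `&` K !=set0).
      have [v [Sv Kv] maxv] := max_exists x K cK SK0.
      exists v; split=> //; split=> // u /maxw/le_trans; apply.
      rewrite leNgt; apply/negP => /rat_in_itvoo[q /itvP qvw].
      apply: nbad; exists q => //; split.
        by exists w; split; rewrite //= qvw.
      move=> [u' [Su [Ku /= qu]]].
      by have := le_trans qu (maxv _ (conj Su Ku)); rewrite leNgt qvw.
    (* No path of [S x] lies in [K], so any rational level below the maximum [F w] is bad. *)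
    have /rat_in_itvoo[q /itvP qw] : F w - 1 < F w by rewrite ltrBlDr ltrDl.
    exfalso; apply: nbad; exists q => //; split.
      by exists w; split; rewrite //= qw.
    by move=> [u [Su [Ku _]]]; apply: nSK; exists u.
  apply: borel_setC; apply: borel_bigcup_rat => q.
  by apply: borel_setD; apply: S2 => //; exact: closedI.
(* If some [v] in [S (w s)] beat the shifted path, splicing it into [w] at [s] would beat [w]. *)
- split=> [|v Sv]; first exact: S3 Sw.
  have [_ _ Sws] := S1 (w s); have wsv0 : w s = v 0 by rewrite (Sws _ Sv).
  have [c c0 dFs] := dF s.
  have := maxw _ (S4 _ _ _ _ wsv0 Sw Sv).
  by rewrite -subr_le0 dFs pmulr_rle0// subr_le0.
(* The shifted [w] competes with [v] in [S (w s)], so replacing the tail of [w] by [v] does not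
   lower [F], and [w] was already maximal. *)
- split=> [|u Su]; first exact: S4 Sw Sv.
  have [c c0 dFs] := dF s.
  apply: le_trans (maxw _ Su) _.
  rewrite -subr_ge0 dFs pmulr_rge0// subr_ge0; apply: maxv; exact: S3 Sw.
Qed.

(** Compactness makes the intersection nonempty and, applied to [S n x] intersected with [K], turns
    the set in (S2) into a countable intersection of Borel sets. *)
Lemma bigcap_admissible (S : (X -> set Omega)^nat) :
  (forall n, admissible (S n)) -> (forall n x, S n.+1 x `<=` S n x) ->
  admissible (fun x => \bigcap_n S n x).
Proof.
move=> aS Sdec; split=> [x|K cK|x s w Sw n _|x s w v wsv0 Sw Sv n _].
- split.
  + apply: nonincreasing_compact_bigcap => [|n|n|n //].
    * exact: path_space_hausdorff.
    * by have [/(_ x)[]] := aS n.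
    * by have [/(_ x)[]] := aS n.
  + have cS n : compact (S n x) by have [/(_ x)[]] := aS n.
    apply: (subclosed_compact _ (cS 0%N)); last by move=> w; apply.
    apply: closed_bigI => n _; apply: compact_closed (cS n).
    exact: path_space_hausdorff.
  + by move=> w /(_ 0%N I); have [/(_ x)[_ _ +] _ _ _] := aS 0%N; apply.
- rewrite (_ : [set _ | _] = \bigcap_n [set x | S n x `&` K !=set0]).
    by apply: borel_bigcap => n; have [_ S2 _ _] := aS n; exact: S2.
  apply/seteqP; split=> x /=.
    by move=> [w [Sw Kw]] n _; exists w; split=> //; exact: Sw.
  move=> SK; have [||n||w SKw] := @nonincreasing_compact_bigcap Omega
      (fun n => S n x `&` K).
  + exact: path_space_hausdorff.
  + by move=> n; apply: compact_closedI => //; have [/(_ x)[]] := aS n.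
  + exact: SK.
  + by move=> n; apply: setSI; exact: Sdec.
  + by exists w; split=> [n _|]; [have [] := SKw n I|have [] := SKw 0%N I].
- by have [_ _ S3 _] := aS n; exact: S3 (Sw n I).
- by have [_ _ _ S4] := aS n; exact: S4 (Sw n I) (Sv n I).
Qed.

(** Maximizing [F n] at stage [n.+1] makes it constant on that stage, and the limit is contained in
    every stage. *)
Lemma admissible_constant_functionals S (F : nat -> Omega -> R) :
  admissible S ->
  (forall n, continuous (F n)) -> (forall n, discounted (F n)) ->
  exists2 S', admissible S' & forall x, S' x `<=` S x /\
    forall n w v, S' x w -> S' x v -> F n w = F n v.
Proof.
move=> aS cF dF.
pose Sn := fix Sn n := if n is m.+1 then argmax (Sn m) (F m) else S.
have aSn n : admissible (Sn n) by elim: n => //= n; exact: argmax_admissible.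
exists (fun x => \bigcap_n Sn n x).
  by apply: bigcap_admissible => // n x w [].
move=> x; split=> [w /(_ 0%N I) //|n w v].
move=> /(_ n.+1 I)[Sw maxw] /(_ n.+1 I)[Sv maxv].
by apply/eqP; rewrite eq_le maxv// maxw.
Qed.

(** With one path in each [S x], (S2) describes the preimages of closed sets, and (S3) forces the
    shift of [u x] by [s] to be [u (u x s)]. *)
Lemma admissible_subsingleton_selection S :
  admissible S -> (forall x w v, S x w -> S x v -> w = v) ->
  exists u : X -> Omega, [/\ borel_measurable u, forall x, S x (u x) &
    forall s t x, u (u x s) t = u x (s + t)].
Proof.
move=> [S1 S2 S3 S4] S_inj.
have S0 x : exists w, S x w by have [] := S1 x.
pose u x := projT1 (cid (S0 x)); have Su x : S x (u x) := projT2 (cid (S0 x)).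
exists u; split=> // [|s t x].
  apply: borel_measurable_closed => K cK.
  rewrite (_ : u @^-1` K = [set x | S x `&` K !=set0]); first exact: S2.
  apply/seteqP; split=> x /=; first by exists (u x).
  by move=> [w [Sw Kw]]; rewrite (S_inj _ _ _ (Su x) Sw).
by rewrite (S_inj _ _ _ (Su (u x s)) (S3 _ s _ (Su x))).
Qed.

End Selection.

(** * Laplace transforms along paths *)

Section Sampling.
Context {R : realType}.
Implicit Types (k : time_kind) (r x : R).

(** Negative reals go to 0 in both cases, since [Num.truncn] vanishes on them. *)
Definition sample_val k r : R :=
  match k with
  | ContinuousTime => Num.max 0 r
  | DiscreteTime => (Num.truncn r)%:R
  end.

Lemma sample_valP k r : time_set R k (sample_val k r).
Proof. by case: k => /=; [rewrite le_max lexx|exists (Num.truncn r)]. Qed.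

Definition sample k r : time R k := SigSub (mem_set (sample_valP k r)).

Lemma time_val_sample k r : time_val (sample k r) = sample_val k r.
Proof. by []. Qed.

Lemma sample0 k : sample k 0 = 0.
Proof.
apply: time_val_inj; rewrite time_val0; case: k; first exact: maxxx.
exact: (congr1 (GRing.natmul 1) (@natrK R 0%N)).
Qed.

Lemma sampleD k (s : time R k) r : 0 <= r ->
  sample k (time_val s + r) = s + sample k r.
Proof.
move=> r0; apply: time_val_inj; rewrite time_valD !time_val_sample.
move: (time_val_ge0 s) (time_valP s); move: (time_val s) => {s} y y0.
case: k => /= [_|[n _ <-]]; first by rewrite !max_r// addr_ge0.
by rewrite truncnD ?natr_nat// natrD natrK.
Qed.

Lemma sample_time k (s : time R k) : sample k (time_val s) = s.
Proof. by rewrite -[time_val s]addr0 sampleD// sample0 addr0. Qed.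

Lemma sample_le k (s : time R k) r : 0 <= r -> r <= time_val s ->
  time_val (sample k r) <= time_val s.
Proof.
move=> r0 /(le_trans _); apply; rewrite time_val_sample.
by case: k s => s /=; [rewrite max_r|rewrite truncn_le].
Qed.

Lemma sample_continuous : continuous (sample ContinuousTime).
Proof.
apply: continuous_to_time => r.
apply: (@continuous_max R R (cst 0) idfun); first exact: cst_continuous.
exact: cvg_id.
Qed.

(** Paths converge uniformly on compact sets of times; this supplies one for each bounded range of
    real times, the image of a segment, which is finite in discrete time. *)
Lemma sample_compact k (b : R) :
  exists2 C : set (time R k), compact C &
    forall r, 0 <= r <= b -> C (sample k r).
Proof.
exists (sample k @` `[0, b]); last first.
  by move=> r rb; exists r => //=; rewrite in_itv.
case: k; last first.
  apply: finite_compact.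
  apply: (@sub_finite_set _ _
    ((fun n : nat => sample DiscreteTime n%:R) @` `I_(Num.truncn b).+1)).
    move=> s [r /=]; rewrite in_itv/= => /andP[r0 rb] <-.
    exists (Num.truncn r); first by rewrite /= ltnS le_truncn.
    by apply: time_val_inj; rewrite !time_val_sample/= natrK.
  exact/finite_image/finite_II.
apply: continuous_compact (@segment_compact _ _ _).
by apply: continuous_subspaceT => r; exact: sample_continuous.
Qed.

(** One-sided, since sampling jumps in discrete time; there it is constant on [[n, n + 1[], whence
    [d = 1]. *)
Lemma sample_right_continuous k (t : time R k) (U : set (time R k)) :
  nbhs t U -> exists2 d, 0 < d &
    forall r, time_val t <= r < time_val t + d -> U (sample k r).
Proof.
case: k t U => t U tU.
  have := @sample_continuous (time_val t).
  rewrite -{1}[t]sample_time in tU; move=> /(_ _ tU).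
  move=> /nbhs_ballP[d/= d0 dU]; exists d => // r /andP[tr rd]; apply: dU.
  by rewrite /ball/= ler0_norm ?subr_le0// opprB ltrBlDl.
exists 1 => // r /andP[tr rd].
suff -> : sample DiscreteTime r = t by exact: nbhs_singleton.
apply: time_val_inj; have [n _ nt] := time_valP t.
rewrite time_val_sample; move: tr rd; rewrite -nt /= => nr rn.
by rewrite (@truncn_def _ _ n)// nr -natr1.
Qed.

Lemma measurable_sample k (h : time R k -> R) : continuous h ->
  measurable_fun setT (h \o sample k).
Proof.
case: k h => h ch.
  apply: continuous_measurable_fun => r.
  by apply: continuous_comp; [exact: sample_continuous|exact: ch].
move=> _ B mB; rewrite setTI.
have -> : (h \o sample DiscreteTime) @^-1` B =
    \bigcup_(n in [set n : nat | B (h (sample DiscreteTime n%:R))])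
      [set r | Num.truncn r = n].
  have E r : sample DiscreteTime r = sample DiscreteTime (Num.truncn r)%:R.
    by apply: time_val_inj; rewrite !time_val_sample/= natrK.
  apply/seteqP; split=> r /=; first by rewrite E => Br; exists (Num.truncn r).
  by move=> [n /= Bn trn]; rewrite E trn.
(* The level set of 0 is treated apart because it also contains the negative reals. *)
apply: bigcup_measurable => -[|n] _.
  rewrite (_ : [set _ | _] = `]-oo, 1[%classic); first exact: measurable_itv.
  apply/seteqP; split=> r /=; rewrite in_itv/=.
    by move=> r0; rewrite ltNge; apply/negP; rewrite -truncn_gt0 r0.
  by rewrite ltNge => /truncn0Pn.
rewrite (_ : [set _ | _] = `[n.+1%:R, n.+2%:R[%classic).
  exact: measurable_itv.
apply/seteqP; split=> r /=; rewrite in_itv/=; last exact: truncn_def.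
move=> rn; have r0 : 0 <= r.
  by rewrite (@le_trans _ _ 1)// -truncn_gt0 rn.
by rewrite -rn truncn_itv.
Qed.

(* The substitution [x = e^(-t)] turns [\int_0^oo e^(-(n + 1)t) h t dt] into
   [moment n (exp_sample h)]. *)
Definition exp_sample k (h : time R k -> R) : R -> R :=
  fun x => h (sample k (- ln x)).

Lemma measurable_exp_sample k (h : time R k -> R) : continuous h ->
  measurable_fun setT (exp_sample h).
Proof.
move=> ch; apply: (@measurableT_comp _ _ _ _ _ _ (h \o sample k)).
  exact: measurable_sample.
by apply: measurableT_comp => //; exact: measurable_ln.
Qed.

Lemma exp_sample_shift k (h : time R k -> R) s x : 0 < x <= 1 ->
  exp_sample h (expR (- time_val s) * x) = exp_sample (fun t => h (s + t)) x.
Proof.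
move=> /andP[x0 x1]; rewrite /exp_sample lnM ?posrE ?expR_gt0// expRK.
by rewrite opprD opprK sampleD// oppr_ge0 ln_le0.
Qed.

(** If [g t > h t], right continuity keeps a gap on [[t, t + d[]. The exponential substitution makes
    this an interval of []0, 1]] on which the difference is at least [e], so some moments differ by
    [moments_nonzero]. *)
Lemma exp_sample_inj k (g h : time R k -> R) : continuous g -> continuous h ->
  (forall t, 0 <= g t <= 1) -> (forall t, 0 <= h t <= 1) ->
  (forall n, moment n (exp_sample g) = moment n (exp_sample h)) ->
  forall t, g t <= h t.
Proof.
move=> cg ch g01 h01 gh t; rewrite leNgt; apply/negP => htgt.
pose e := (g t - h t) / 2.
have e0 : 0 < e by rewrite divr_gt0// subr_gt0.
have ght : \forall t' \near t, e < g t' - h t'.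
  have ghc : g t' - h t' @[t' --> t] --> g t - h t.
    by apply: (@cvgB R R^o (time R k) (nbhs t) _ g h); [exact: cg|exact: ch].
  move/cvgrPdist_lt : ghc => /(_ e e0); apply: filterS => t' /=.
  rewrite /e ltr_norml => /andP[]; lra.
have [d d0 ghd] := sample_right_continuous ght.
have t0 := time_val_ge0 t.
have [|||||||n /eqP] := @moments_nonzero R (exp_sample g \- exp_sample h)
    (expR (- (time_val t + d))) (expR (- time_val t)) e.
- exact: expR_ge0.
- by rewrite ltr_expR ltrN2 ltrDl.
- by rewrite expR_le1 oppr_le0.
- exact: e0.
- by apply: measurable_funB; exact: measurable_exp_sample.
- move=> x _; rewrite /= /exp_sample ler_norml.
  have /andP[? ?] := g01 (sample k (- ln x)).
  by have /andP[? ?] := h01 (sample k (- ln x)); apply/andP; split; lra.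
- move=> x /andP[xt tx]; apply/ltW/ghd.
  have x0 : 0 < x by apply: lt_trans xt; exact: expR_gt0.
  rewrite -[x]lnK ?posrE// !ltr_expR in xt tx.
  by apply/andP; split; lra.
apply; rewrite momentB ?gh ?subrr//; try exact: measurable_exp_sample.
- by move=> x _; have /andP[? ?] := g01 (sample k (- ln x)); rewrite ger0_norm.
- by move=> x _; have /andP[? ?] := h01 (sample k (- ln x)); rewrite ger0_norm.
Qed.

End Sampling.

(** * Moments of truncated distances along paths *)

Section DiscountedDistance.
Context {R : realType} {k : time_kind} {X : metricType R}.
Local Notation T := (time R k).
Local Notation Omega := (path_space R k X).
Implicit Types (w v : Omega) (s t : T) (p y z : X) (n : nat).

Definition truncated_dist p y : R := Num.min 1 (mdist p y).

Lemma truncated_dist01 p y : 0 <= truncated_dist p y <= 1.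
Proof. by rewrite le_min ler01 mdist_ge0 ge_min lexx. Qed.

Lemma truncated_dist_lipschitz p y z :
  `|truncated_dist p y - truncated_dist p z| <= mdist y z.
Proof.
have yz := metric_triangle p y z; have zy := metric_triangle p z y.
rewrite [mdist z y]metric_sym in zy; have yz0 := mdist_ge0 y z.
rewrite /truncated_dist ler_norml !minEle.
by case: (leP 1 (mdist p y)) => ?; case: (leP 1 (mdist p z)) => ?;
  apply/andP; split; lra.
Qed.

Lemma truncated_dist_path_continuous p w :
  continuous (fun t => truncated_dist p (w t)).
Proof.
move=> t.
apply/(@cvgrPdist_lt R R^o T (nbhs t) (nbhs_filter t)) => e e0.
have : \forall t' \near t, mdist (w t) (w t') < e.
  apply: (@metricType_numDomainType.cvgr_dist_lt _ X T (nbhs t)) => //.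
  exact: path_continuous.
by apply: filterS => t' /=; apply: le_lt_trans; exact: truncated_dist_lipschitz.
Qed.

Definition discounted_dist p n w : R :=
  moment n (exp_sample (fun t => truncated_dist p (w t))).

Lemma discounted_dist_continuous p n : continuous (discounted_dist p n).
Proof.
move=> w; apply/(@cvgrPdist_lt R R^o Omega (nbhs w) (nbhs_filter w)) => e e0.
(* Times beyond [- ln c] contribute at most [c <= e / 3], and earlier ones at most [e / 3] once the
   paths are that close on the compact set [C]; the sum is below [e]. *)
pose c := Num.min 1 (e / 3).
have c0 : 0 < c by rewrite lt_min ltr01 divr_gt0.
have c1 : c <= 1 by rewrite ge_min lexx.
have [C cC sC] := @sample_compact R k (- ln c).
have ent : entourage [set yz : X * X | mdist yz.1 yz.2 < e / 3].
  rewrite -entourage_ballE; exists (e / 3); first by rewrite /= divr_gt0.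
  by move=> [y z] /=; rewrite ballEmdist.
apply: filterS (nbhs_path w cC ent) => v /= wv.
apply: (@le_lt_trans _ _ (c + e / 3)); last first.
  have : c <= e / 3 by rewrite ge_min lexx orbT.
  lra.
apply: moment_dist => //; rewrite ?c0 ?divr_ge0 ?(ltW e0)//.
- by apply: measurable_exp_sample; exact: truncated_dist_path_continuous.
- by apply: measurable_exp_sample; exact: truncated_dist_path_continuous.
- by move=> x _; exact: truncated_dist01.
- by move=> x _; exact: truncated_dist01.
move=> x /andP[cx x1]; apply: le_trans (truncated_dist_lipschitz _ _ _) _.
have x0 : 0 < x by exact: lt_trans cx.
apply/ltW/wv/sC; rewrite oppr_ge0 ln_le0//= lerN2 ler_ln ?posrE//.
exact: ltW.
Qed.

Lemma path_spliceE w v s (wsv0 : w s = v 0) t :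
  path_splice wsv0 t = splice_fun s w v t.
Proof. by []. Qed.

Lemma path_splice_before w v s t (wsv0 : w s = v 0) :
  time_val t <= time_val s -> path_splice wsv0 t = w t.
Proof. by move=> ts; rewrite path_spliceE /splice_fun ts. Qed.

Lemma path_splice_after w v s t (wsv0 : w s = v 0) :
  path_splice wsv0 (s + t) = v t.
Proof.
(* The first branch of the splicing is reached only at [t = 0], where [w s = v 0]. *)
have t0 := time_val_ge0 t; rewrite path_spliceE /splice_fun; case: ifPn => st.
  have -> : t = 0.
    apply: time_val_inj; rewrite time_val0; apply/eqP; rewrite eq_le t0 andbT.
    by move: st; rewrite time_valD gerDl.
  by rewrite addr0 wsv0.
congr (v _); apply: time_val_inj.
by rewrite time_valB time_valD addrAC subrr add0r; exact: max_r.
Qed.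

(** With [c = e^(-s)], the points of []c, 1]] are times before [s], where splicing changes nothing,
    so they cancel. On []0, c]], [moment_scale] leaves [c ^+ n.+1] times the moment along the
    shifted path, which is [v] for the spliced one. *)
Lemma discounted_dist_discounted p n : discounted (discounted_dist p n).
Proof.
move=> s; pose c := expR (- time_val s).
have c0 : 0 < c by exact: expR_gt0.
have c1 : c <= 1 by rewrite expR_le1 oppr_le0 time_val_ge0.
have c01 : 0 < c <= 1 by rewrite c0 c1.
exists (c ^+ n.+1); first exact: exprn_gt0.
move=> w v wsv0; set ws := path_splice wsv0.
pose f u : R -> R := exp_sample (fun t => truncated_dist p (u t)).
have mf (u : Omega) : measurable_fun setT (f u).
  by apply: measurable_exp_sample; exact: truncated_dist_path_continuous.
have f01 (u : Omega) x : 0 < x <= 1 -> 0 <= f u x <= 1.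
  by move=> _; exact: truncated_dist01.
have f1 (u : Omega) x : 0 < x <= 1 -> `|f u x| <= 1.
  by move=> /(f01 u)/andP[? ?]; rewrite ger0_norm.
have headE : \int[lebesgue_measure]_(x in `]c, 1]) (x ^+ n * f ws x) =
             \int[lebesgue_measure]_(x in `]c, 1]) (x ^+ n * f w x).
  apply: eq_Rintegral => x /set_mem /=; rewrite in_itv/= => /andP[cx x1].
  have x0 : 0 < x by exact: lt_trans cx.
  congr (_ * truncated_dist _ _); apply: path_splice_before.
  apply: sample_le; first by rewrite oppr_ge0 ln_le0.
  by rewrite lerNl -[leLHS]expRK ler_ln ?posrE//; exact: ltW.
have tailE (u u' : Omega) : (forall t, u (s + t) = u' t) ->
    moment n (fun x => f u (c * x)) = moment n (f u').
  move=> uu'; apply: eq_Rintegral => x /set_mem /=; rewrite in_itv/= => x01.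
  rewrite /f exp_sample_shift//; congr (_ * truncated_dist _ _); exact: uu'.
rewrite /discounted_dist -!/(f _).
rewrite (moment_split n c01 (mf ws) (f1 ws)).
rewrite (moment_split n c01 (mf w) (f1 w)).
rewrite headE opprD addrACA subrr addr0.
rewrite (moment_scale n c01 (mf ws) (f01 ws)).
rewrite (moment_scale n c01 (mf w) (f01 w)).
rewrite (tailE ws v); last by move=> t; exact: path_splice_after.
by rewrite (tailE w (path_shift s w))// -mulrBr.
Qed.

(** If [w t] and [v t] differ, a point [p] of [D] close to [w t] has a larger truncated distance to
    [v t] than to [w t], against [exp_sample_inj]. *)
Lemma discounted_dist_separates (D : set X) w v : dense D ->
  (forall p n, D p -> discounted_dist p n w = discounted_dist p n v) -> w = v.
Proof.
move=> dD wv; apply: path_eq => t; apply: contrapT => wvt.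
have {wvt} d0 : 0 < mdist (w t) (v t) by rewrite mdist_gt0; exact/eqP.
(* If [p] is within [d] of [w t], then [v t] is farther than [d] from [p] by the triangle
   inequality, and [d <= 1 / 2] keeps the truncation at 1 from hiding this. *)
pose d := Num.min 1 (mdist (w t) (v t)) / 2.
have dgt0 : 0 < d by rewrite divr_gt0// lt_min ltr01.
have [|p [wp Dp]] := dD _ _ (@open_interior _ (ball (w t) d)).
  by exists (w t); exact: nbhsx_ballx.
move/interior_subset : wp; rewrite ballEmdist/= => wp.
have := @exp_sample_inj R k (fun t => truncated_dist p (v t))
  (fun t => truncated_dist p (w t)) (@truncated_dist_path_continuous p v)
  (@truncated_dist_path_continuous p w) (fun t => truncated_dist01 p (v t))
  (fun t => truncated_dist01 p (w t)) (fun n => esym (wv p n Dp)) t.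
apply/negP; rewrite -ltNge /truncated_dist.
have := metric_triangle (w t) p (v t); rewrite [mdist p (w t)]metric_sym.
move: wp; rewrite /d; move: (mdist _ _) (mdist _ _) (mdist _ _) d0 => a b c.
by rewrite !minEle; case: (leP 1 a); case: (leP 1 b); case: (leP 1 c); lra.
Qed.

End DiscountedDistance.

Theorem theorem1 (R : realType) (X : metricType R) (k : time_kind)
    (sepX : separable_space X) (completeX : complete_space X)
    (S : X -> set (path_space R k X))
    (S1 : forall x : X,
       [/\ S x !=set0, compact (S x) & S x `<=` paths_from x])
    (S2 : forall K : set (path_space R k X), closed K ->
       borel_set [set x : X | S x `&` K !=set0])
    (S3 : forall (x : X) (s : time R k) (w : path_space R k X),
       S x w -> S (w s) (path_shift s w))
    (S4 : forall (x : X) (s : time R k) (w v : path_space R k X)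
       (wsv0 : w s = v 0),
       S x w -> S (w s) v -> S x (path_splice wsv0)) :
  exists u : X -> path_space R k X,
    [/\ borel_measurable u,
        forall x : X, S x (u x),
        forall (t1 t2 : time R k) (x : X), u (u x t1) t2 = u x (t1 + t2),
        forall t : time R k, borel_measurable (time_map u t) &
        time_map u 0 = id /\
        forall t1 t2 : time R k,
          time_map u (t1 + t2) = time_map u t2 \o time_map u t1].
Proof.
have [D cD dD] := sepX.
have aS : admissible S by [].
pose functional (pn : X * nat) := discounted_dist (k := k) pn.1 pn.2.
have [F FP Fall] : exists2 F : nat -> path_space R k X -> R,
    forall m, continuous (F m) /\ discounted (F m) &
    forall p n, D p -> exists m, F m = discounted_dist p n.
  have /pcard_surjP[g gD] : countable (functional @` (D `*` setT)).
    apply: sub_countable (card_image_le _ _) _.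
    by apply: countableX => //; exact: countableP.
  (* [g] covers the family but may take values outside it; these are replaced by the zero
     functional, which is continuous and discounted. *)
  pose F m := if pselect ((functional @` (D `*` setT)) (g m)) then g m
              else (fun=> 0).
  exists F.
    move=> m; rewrite /F; case: pselect => [gm|_] /=; split.
    - by have [pn _ <-] := gm; exact: discounted_dist_continuous.
    - by have [pn _ <-] := gm; exact: discounted_dist_discounted.
    - exact: cst_continuous.
    - by move=> s; exists 1 => // w v wsv0; rewrite !subrr mulr0.
  move=> p n Dp; have [|m _ gm] := gD (discounted_dist p n).
    by exists (p, n).
  exists m; rewrite /F gm; case: pselect => // -[].
  by exists (p, n).
have [S' aS' S'P] := admissible_constant_functionals aS
  (fun m => (FP m).1) (fun m => (FP m).2).
have S'_inj x w v : S' x w -> S' x v -> w = v.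
  move=> S'w S'v; apply: discounted_dist_separates dD _ => p n Dp.
  by have [m <-] := Fall p n Dp; have [_] := S'P x; exact.
have [u [mu S'u usg]] := admissible_subsingleton_selection aS' S'_inj.
have Su x : S x (u x) by have [+ _] := S'P x; exact.
(* The position at time [t] is [u] followed by evaluation at [t], which is continuous and hence
   Borel. *)
exists u; split=> // [t B bB|].
  apply: (mu ((fun w : path_space R k X => w t) @^-1` B)).
  apply: borel_measurable_closed bB => K cK.
  rewrite -[K]setCK preimage_setC; apply: borel_setC; apply: borel_open.
  apply: open_comp (closed_openC cK) => w _; exact: path_eval_continuous.
split=> [|t1 t2]; apply/funext => x; rewrite /time_map/= ?usg//.
by have [_ _ Sx] := S1 x; exact: Sx (Su x).
Qed.
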